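(* Two starlike trees $S_n$ and $S_{n'}$ (on $n$ and $n'$ vertices respectively) are isomorphic if and only if they have the same path sequence.
   Context: Graphs are finite and simple. A path of length $h$ in $G$ is a subgraph that is a path with $h$ edges ($h+1$ distinct vertices); paths are undirected, and paths of length $0$ are single vertices. $P_h(G)$ is the number of paths of length $h$ in $G$. The path sequence of $G$ is $P(G)=(P_0(G),P_1(G),\ldots,P_\rho(G))$, where $\rho=\rho(G)$ is the length of a longest path in $G$. A starlike tree is a tree with exactly one vertex of degree greater than $2$. *)

(* Defs.v *)
From HB Require Import structures.
From mathcomp Require Import all_boot.

Set Implicit Arguments.
Unset Strict Implicit.
Unset Printing Implicit Defensive.

Record sgraph := SGraph {
  vertex :> finType;
  edge : rel vertex;
  edge_sym : symmetric edge;
  edge_irrefl : irreflexive edge }.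

Definition isomorphic (G H : sgraph) : Prop :=
  exists2 f : G -> H, bijective f & forall x y, edge (f x) (f y) = edge x y.

Definition degree (G : sgraph) (x : G) : nat := #|[set y | edge x y]|.

Definition connected (G : sgraph) : Prop :=
  0 < #|G| /\ forall x y : G, connect (@edge G) x y.

(* The bound on the size excludes the closed walks x, y, x along one edge. *)
Definition acyclic (G : sgraph) : Prop :=
  forall c : seq G, 2 < size c -> uniq c -> ~~ cycle (@edge G) c.

Definition tree (G : sgraph) : Prop := connected G /\ acyclic G.

Definition starlike (G : sgraph) : Prop :=
  tree G /\ exists! x : G, 2 < degree x.

(* The subgraph (vertex set, edge set) traced by a walk; a path and its
   reversal trace the same subgraph, so that counting traces counts undirected
   paths. *)
Definition trace (G : sgraph) (s : seq G) : {set G} * {set {set G}} :=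
  ([set x in s], [set [set p.1; p.2] | p in zip s (behead s)]).

Definition paths (G : sgraph) (h : nat) : {set {set G} * {set {set G}}} :=
  [set trace t | t : h.+1.-tuple G & uniq t && sorted (@edge G) t].

Definition num_paths (G : sgraph) (h : nat) : nat := #|paths G h|.

(* A path of length h has h + 1 distinct vertices, hence h < #|G|. *)
Definition longest_path (G : sgraph) : nat :=
  \max_(h < #|G| | 0 < num_paths G h) h.

Definition path_sequence (G : sgraph) : seq nat :=
  mkseq (num_paths G) (longest_path G).+1.

(* Main.v *)
(* Only the "if" direction needs work.  Let a_m be the number of arms of length
   at least m.  In a tree, 2 P_h counts the ordered pairs of vertices at
   distance h; sorting these by whether the two vertices lie on the same arm
   gives, for h > 0 and n vertices,
     2 P_h + sum_(0<m<h) a_(max(m, h-m)) + 2 sum_(0<m<h) a_m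
       = 2 (n - 1) + sum_(0<m<h) a_m a_(h-m).
   For h = 2 this determines a_1 >= 3.  For h > 2 the coefficient of a_(h-1) is
   2 (a_1 - 2) > 0 and the other terms involve a_1, ..., a_(h-2) only, so the
   sequence (P_h) determines (a_m), hence the multiset of arm lengths, hence the
   tree. *)
Require Import Defs.
From mathcomp Require Import all_boot zify.

Set Implicit Arguments.
Unset Strict Implicit.
Unset Printing Implicit Defensive.

(** * Simple paths in acyclic graphs *)

Definition simple_path (G : sgraph) (x : G) (p : seq G) : bool :=
  path (@edge G) x p && uniq (x :: p).

Lemma simple_path_cons (G : sgraph) (x y : G) p :
  simple_path x (y :: p) -> simple_path y p.
Proof. by case/andP=> /= /andP[_ ep] /andP[_ up]; rewrite /simple_path ep. Qed.

Lemma simple_path_catl (G : sgraph) (x : G) p q :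
  simple_path x (p ++ q) -> simple_path x p.
Proof.
rewrite /simple_path cat_path -cat_cons cat_uniq.
by case/andP=> /andP[-> _] /andP[-> _].
Qed.

Lemma simple_path_rcons (G : sgraph) (x y : G) p :
  simple_path x (rcons p y) =
  [&& simple_path x p, edge (last x p) y & y \notin x :: p].
Proof.
rewrite /simple_path rcons_path -rcons_cons rcons_uniq.
by case: (path _ _ _); case: (edge _ _); case: (_ \notin _); case: (uniq _).
Qed.

Lemma simple_path_loop (G : sgraph) (x : G) p :
  simple_path x p -> last x p = x -> p = [::].
Proof.
case: p => // y p /andP[_ /andP[nx _]] /= Ex.
by case/negP: nx; have := mem_last y p; rewrite Ex.
Qed.

Lemma simple_path_rev (G : sgraph) (x : G) p :
  simple_path x p -> simple_path (last x p) (rev (belast x p)).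
Proof.
case/andP=> ep up; apply/andP; split.
  rewrite rev_path; rewrite (eq_path (e' := @edge G)) // => u v.
  exact: edge_sym.
by rewrite -rev_rcons -lastI rev_uniq.
Qed.

(** If the paths part right after [x], towards [a] and [b], then following [p] from [a] and
    returning along [q] to [b] avoids [x]; shortened, this walk closes up through [x] to a cycle. *)
Lemma acyclic_simple_path_inj (G : sgraph) (x : G) p q :
  acyclic G -> simple_path x p -> simple_path x q -> last x p = last x q ->
  p = q.
Proof.
move=> acG; elim: p x q => [|a p IHp] x q sp sq Epq.
  by rewrite (simple_path_loop sq).
case: q => [|b q] in sq Epq *; first by rewrite (simple_path_loop sp).
have [Eab|nab] := eqVneq a b.
  rewrite -Eab in sq Epq *; congr (_ :: _).
  exact: IHp (simple_path_cons sp) (simple_path_cons sq) Epq.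
case/andP: sp => /= /andP[exa ep] /andP[nxp _].
case/andP: (sq) => /= /andP[exb _] /andP[nxq _].
have /andP[er _] := simple_path_rev (simple_path_cons sq).
rewrite /= in Epq; rewrite -Epq in er.
have: path (@edge G) a (p ++ rev (belast b q)) by rewrite cat_path ep.
have: last a (p ++ rev (belast b q)) = b.
  rewrite last_cat Epq; case: (q) => [|d r] //=; by rewrite rev_cons last_rcons.
have: x \notin a :: p ++ rev (belast b q).
  rewrite -cat_cons mem_cat negb_or nxp mem_rev.
  by apply: contra nxq => /mem_belast.
move=> nxr Er ecat; case/shortenP: ecat Er => r' er' ur' sr' Er.
have nxr' : x \notin a :: r'.
  apply: contra nxr; rewrite !inE => /orP[->//|/sr' ->]; exact: orbT.
have := acG (x :: a :: r'); rewrite /= rcons_path exa er' Er edge_sym exb.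
rewrite nxr' => H; move: ur' => /= ur'; rewrite ur' in H.
(* The cycle has at least three vertices unless [r'] is empty, and then [a = b]. *)
case: r' => [|? ?] in er' ur' sr' nxr' H Er *; last by have := H isT isT.
by rewrite /= in Er; rewrite Er eqxx in nab.
Qed.

Lemma connect_simple_path (G : sgraph) (x y : G) :
  connect (@edge G) x y -> exists2 p, simple_path x p & last x p = y.
Proof.
case/connectP=> p /shortenP[q eq uq _] ->.
by exists q => //; apply/andP.
Qed.

(** A fork would give its vertex three neighbours: the predecessor and two successors. Hence an arm
    does not branch away from the center. *)
Lemma degree_le2_simple_path_inj (G : sgraph) (x y : G) s t :
  simple_path x (y :: s) -> simple_path x (y :: t) -> size s = size t ->
  (forall z, z \in y :: s -> degree z <= 2) -> s = t.
Proof.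
elim: s x y t => [|a s IHs] x y [|b t] //= ss st [Est] deg.
have Eab : a = b.
  apply/eqP; apply: contraTT (deg y (mem_head _ _)) => nab; rewrite -ltnNge.
  case/andP: ss => /= /and3P[exy eya _] /andP[]; rewrite !inE !negb_or.
  case/and3P=> nxy nxa _ _.
  case/andP: st => /= /and3P[_ eyb _] /andP[]; rewrite !inE !negb_or.
  case/and3P=> _ nxb _ _.
  have sub : [set x; a; b] \subset [set z | edge y z].
    apply/subsetP=> z; rewrite !inE => /orP[/orP[]|] /eqP-> //.
    by rewrite edge_sym.
  apply: leq_trans (subset_leq_card sub).
  by rewrite -setUA cardsU1 cards2 nab !inE negb_or nxa nxb.
rewrite -Eab in st *; congr (_ :: _).
apply: (IHs y a t) (simple_path_cons ss) (simple_path_cons st) Est _.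
by move=> z zs; apply: deg; rewrite inE zs orbT.
Qed.

(** * Coordinates on a starlike tree *)

(* The vertices of the starlike tree with arm lengths l, as pairs (arm,
   distance to the center); the center is placed on the extra arm size l. *)
Definition spider (l : seq nat) : seq (nat * nat) :=
  (size l, 0) ::
  [seq (i, m) | i <- iota 0 (size l), m <- iota 1 (nth 0 l i)].

(** The tree metric: on one arm the truncated differences add up to the absolute difference, and
    between arms the route passes through the center. The center, alone on its arm at distance 0,
    fits the second case. *)
Definition spider_dist (p q : nat * nat) : nat :=
  if p.1 == q.1 then (p.2 - q.2) + (q.2 - p.2) else p.2 + q.2.

(** Since [spider l] has no repetitions, the permutation makes [f] a bijection onto it. *)
Definition coordinates (G : sgraph) (l : seq nat) (f : G -> nat * nat) : Prop :=
  perm_eq (codom f) (spider l) /\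
  forall x y : G, edge x y = (spider_dist (f x) (f y) == 1).

Lemma spider_distC p q : spider_dist p q = spider_dist q p.
Proof. by rewrite /spider_dist eq_sym addnC [q.2 + _]addnC. Qed.

Lemma mem_spider (l : seq nat) (i m : nat) :
  ((i, m) \in spider l) =
  (i == size l) && (m == 0) || (i < size l) && (0 < m <= nth 0 l i).
Proof.
rewrite inE xpair_eqE; congr (_ || _); apply/allpairsPdep/idP => /=.
  case=> j [k []]; rewrite !mem_iota add1n ltnS => /andP[_ jl] km [-> ->].
  by rewrite jl.
by case/andP=> il im; exists i, m; rewrite !mem_iota add1n ltnS.
Qed.

Lemma uniq_spider l : uniq (spider l).
Proof.
rewrite /= allpairs_uniq_dep ?iota_uniq ?andbT //=.
- apply/negP=> /allpairsPdep[i [m [_]]]; rewrite mem_iota => /andP[m0 _] [_ Em].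
  by rewrite -Em in m0.
- by move=> i _; rewrite iota_uniq.
- by move=> [i m] [j k] _ _ /= [-> ->].
Qed.

(** In a tree rooted at [c], every edge joins a vertex to its parent: if [y] is not on the path to
    [x], that path extends to [y]; otherwise the path to [y] extends to [x]. *)
Lemma edge_root_path (G : sgraph) (c : G) (pth : G -> seq G) (x y : G) :
  (forall z, simple_path c (pth z)) -> (forall z, last c (pth z) = z) ->
  (forall p, simple_path c p -> pth (last c p) = p) ->
  edge x y = (pth y == rcons (pth x) y) || (pth x == rcons (pth y) x).
Proof.
move=> spth lpth upth; apply/idP/orP => [exy|]; last first.
  have aux u v : pth v = rcons (pth u) v -> edge u v.
    move=> E; have := spth v; rewrite E simple_path_rcons lpth.
    by case/and3P.
  by case=> /eqP/aux //; rewrite edge_sym.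
have [yx|nyx] := boolP (y \in c :: pth x); last first.
  left; have sp : simple_path c (rcons (pth x) y).
    by rewrite simple_path_rcons spth lpth exy.
  by rewrite -(upth _ sp) last_rcons.
right; case/splitPl: yx (spth x) (lpth x) => p1 p2 Ey sp Ex.
have sp1 := simple_path_catl sp; have Ep1 := upth _ sp1; rewrite Ey in Ep1.
have sp2 : simple_path c (rcons (pth y) x).
  rewrite simple_path_rcons Ep1 sp1 Ey edge_sym exy /=.
  case/andP: sp => _; rewrite -cat_cons cat_uniq => /and3P[_ /hasPn H _].
  case: p2 => [|b p2] in Ex H *; last first.
    by apply: H; rewrite -Ex last_cat /= mem_last.
  by rewrite cats0 Ey in Ex; rewrite Ex edge_irrefl in exy.
by rewrite -(upth _ sp) Ex -(upth _ sp2) last_rcons.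
Qed.

Lemma starlike_coordinates (G : sgraph) : starlike G ->
  exists l f, [/\ sorted geq l, 2 < size l, all (leq 1) l & @coordinates G l f].
Proof.
case=> [[[_ conG] acG] [c [degc degu]]].
have deg2 z : z != c -> degree z <= 2.
  by apply: contraNT; rewrite -ltnNge => /degu ->.
have /all_sig[pth pthP] x : {p | simple_path c p && (last c p == x)}.
  apply: sigW; have [p sp /eqP lp] := connect_simple_path (conG c x).
  by exists p; rewrite sp.
have spth x : simple_path c (pth x) by case/andP: (pthP x).
have lpth x : last c (pth x) = x by case/andP: (pthP x) => _ /eqP.
have upth p : simple_path c p -> pth (last c p) = p.
  by move=> sp; apply: (acyclic_simple_path_inj acG) (spth _) sp (lpth _).
have pthc : pth c = [::] by apply: (upth [::]).
have pth_nil x : pth x = [::] -> x = c by move=> E; rewrite -(lpth x) E.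
(* The first vertex after [c] names the arm. The default gives [hd c = c], which is not in [arms],
   so the index of the center is [size arms], as in [spider]. *)
pose hd x := head c (pth x).
pose L v := \max_(x | hd x == v) size (pth x).
(* Sorting by decreasing length makes the list of lengths depend only on their multiset. *)
pose arms := sort (fun v w => L w <= L v) (enum [set y | edge c y]).
have mem_arms v : (v \in arms) = edge c v by rewrite mem_sort mem_enum inE.
have arms_uniq : uniq arms by rewrite sort_uniq enum_uniq.
have hd_arms x : x != c -> hd x \in arms.
  rewrite mem_arms /hd => xc; have := spth x.
  case E: (pth x) => [|v p]; first by rewrite (pth_nil x) ?eqxx in xc.
  by case/andP=> /= /andP[].
pose f x := (index (hd x) arms, size (pth x)).
have fc : f c = (size arms, 0).
  by rewrite /f /hd pthc /= memNindex // mem_arms edge_irrefl.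
have hd_arm v : v \in arms -> hd v = v.
  rewrite mem_arms => ecv; rewrite /hd (_ : pth v = [:: v]) //.
  apply: (upth [:: v]); rewrite /simple_path /= ecv inE /= andbT.
  by apply: contraTneq ecv => <-; rewrite edge_irrefl.
have hd_take x m : 0 < m -> head c (take m (pth x)) = hd x.
  by rewrite /hd; case: (pth x) m => [|? ?] [].
have take_pth x m : pth (last c (take m (pth x))) = take m (pth x).
  apply: upth; apply: (@simple_path_catl _ _ _ (drop m (pth x))).
  by rewrite cat_take_drop.
have f_inj : injective f.
  move=> x y []; have [->|xc] := eqVneq x c.
    by rewrite pthc => _ /esym/size0nil/pth_nil.
  have [->|yc] := eqVneq y c; first by rewrite pthc => _ /size0nil/pth_nil.
  move/(index_inj c (hd_arms _ xc) (hd_arms _ yc)); rewrite /hd.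
  move=> Eh Es; rewrite -(lpth x) -(lpth y); congr last; move: Eh Es.
  have := spth x; have := spth y.
  case: (pth x) => [|v s]; first by case: (pth y).
  case: (pth y) => [|w t] //= sw sv Evw [Est].
  rewrite -Evw in sw *; congr (_ :: _).
  apply: (degree_le2_simple_path_inj sv sw Est) => z zs; apply: deg2.
  by case/andP: sv => _ /andP[+ _]; apply: contraNneq => <-.
have size_arms : size (map L arms) = size arms by rewrite size_map.
have nth_arms i : i < size arms -> nth 0 (map L arms) i = L (nth c arms i).
  by move=> il; rewrite (nth_map c).
have f_sub x : f x \in spider (map L arms).
  have [->|xc] := eqVneq x c; first by rewrite fc -size_arms mem_head.
  rewrite mem_spider size_arms index_mem hd_arms //=.
  rewrite nth_arms ?index_mem ?hd_arms //.
  rewrite nth_index ?hd_arms // (leq_bigmax_cond x) // andbT.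
  by rewrite lt0n size_eq0 (contraNneq _ xc) ?orbT // => /pth_nil->.
(* The vertex at distance [m] on an arm is found by truncating a longest path of that arm. *)
have f_sup p : p \in spider (map L arms) -> exists x, f x = p.
  case: p => i m; rewrite mem_spider size_arms => /orP[/andP[/eqP-> /eqP->]|].
    by exists c.
  case/and3P=> il m0; rewrite nth_arms //; set v := nth c arms i => mL.
  have va : v \in arms by rewrite mem_nth.
  have hv := hd_arm _ va.
  have [|x /eqP hx Lx] := @eq_bigmax_cond _ [pred x | hd x == v] (size \o pth).
    by apply/card_gt0P; exists v; rewrite inE hv.
  exists (last c (take m (pth x))).
  rewrite /f /hd take_pth hd_take // hx index_uniq // size_takel //.
  by move: mL; rewrite /L Lx.
have dist_f x y : pth y = rcons (pth x) y -> spider_dist (f x) (f y) = 1.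
  move=> E; have [xc|xc] := eqVneq x c.
    rewrite xc pthc /= in E; rewrite xc fc /f /spider_dist /= /hd E /=.
    rewrite gtn_eqF // index_mem mem_arms.
    by have := spth y; rewrite E => /andP[/= /andP[]].
  rewrite /spider_dist /f /= E size_rcons (_ : hd y = hd x) ?eqxx; first by lia.
  by rewrite /hd E; case Ex: (pth x) => //; rewrite (pth_nil x Ex) eqxx in xc.
have edge_f x y : size (pth x) <= size (pth y) -> spider_dist (f x) (f y) = 1 ->
    pth y = rcons (pth x) y.
  move=> lexy Exy.
  have Es : size (pth y) = (size (pth x)).+1.
    move: Exy lexy; rewrite /spider_dist /=; case: ifP => _; lia.
  set m := size (pth x) in Es.
  have Ey : pth y = rcons (take m (pth y)) y.
    have := lpth y; case/lastP: (pth y) Es => // p z.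
    rewrite size_rcons last_rcons.
    by move=> [<-] ->; rewrite -[in take _ _]cats1 take_size_cat.
  suff -> : pth x = take m (pth y) by [].
  (* It suffices that [x] and the parent of [y] have the same coordinates. For [m > 0], different
     arms would put [x] and [y] at distance [2m + 1 > 1]. *)
  rewrite -take_pth; congr pth; apply: f_inj.
  rewrite /f /hd take_pth size_takel -/m ?Es //.
  have [m0|m0] := posnP m.
    by rewrite m0 take0 (size0nil m0).
  rewrite hd_take //; congr (_, _); move: Exy; rewrite /spider_dist /=.
  by case: eqP => // _; rewrite -/m Es; lia.
exists (map L arms), f; split.
- rewrite sorted_map; apply: sort_sorted => v w; exact: leq_total.
- by rewrite size_arms size_sort -cardE.
- apply/allP=> _ /mapP[v va ->]; apply: leq_trans (leq_bigmax_cond v _).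
    rewrite lt0n size_eq0; apply: contraTneq va => /pth_nil->.
    by rewrite mem_arms edge_irrefl.
  by rewrite hd_arm.
split.
  apply: uniq_perm; rewrite ?uniq_spider //.
    by rewrite map_inj_uniq // enum_uniq.
  move=> p; apply/codomP/idP=> [[x ->] // | /f_sup[x <-]]; by exists x.
move=> x y; rewrite (edge_root_path x y spth lpth upth); apply/orP/eqP.
  by case=> /eqP/dist_f //; rewrite spider_distC.
move=> Exy; case/orP: (leq_total (size (pth x)) (size (pth y))) => le.
  by left; rewrite -(edge_f x y).
by right; rewrite -(edge_f y x) // spider_distC.
Qed.

(** * Geodesics in coordinates *)

Lemma spider_dist_triangle p q r :
  spider_dist p r <= spider_dist p q + spider_dist q r.
Proof.
case: p q r => [i m] [j n] [k o]; rewrite /spider_dist /=.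
by do 3 case: eqP => ?; lia.
Qed.

(** The first step of a geodesic from [p] to [r]: along a common arm, out of the center onto the arm
    of [r], or inwards to the center. *)
Lemma spider_dist_step (l : seq nat) (p r : nat * nat) :
  p \in spider l -> r \in spider l -> p != r ->
  exists q, [/\ q \in spider l, spider_dist p q = 1 &
                spider_dist r p = (spider_dist r q).+1].
Proof.
case: p r => [i m] [j n]; rewrite !mem_spider xpair_eqE => pl rl npr.
case: (eqVneq i j) npr rl => [<-|nij] npr rl.
  rewrite /= in npr.
  have [il|il] := eqVneq i (size l).
    by rewrite il eqxx ltnn /= !orbF in pl rl; rewrite (eqP pl) (eqP rl) in npr.
  rewrite (negbTE il) /= in pl rl; move EL: (nth 0 l i) pl rl => L.
  move=> /and3P[isl m0 mL] /and3P[_ n0 nL].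
  exists (i, if m < n then m.+1 else m.-1).
  rewrite mem_spider isl EL /spider_dist /= eqxx.
  by case: ltnP => mn; split; lia.
have [i_l|i_l] := eqVneq i (size l).
  rewrite i_l eqxx ltnn orbF /= in pl.
  rewrite -i_l [j == i]eq_sym (negbTE nij) /= in rl.
  exists (j, 1); rewrite mem_spider (eqP pl) /spider_dist /= eqxx (negbTE nij).
  rewrite [j == i]eq_sym (negbTE nij) -i_l.
  by case/and3P: rl => jl n0 nL; split; lia.
rewrite (negbTE i_l) /= in pl; case/and3P: pl => il m0 mL.
have [m1|m1] := ltnP 1 m.
  exists (i, m.-1); rewrite mem_spider /spider_dist /= eqxx.
  rewrite [j == i]eq_sym (negbTE nij) il; split; lia.
(* From distance 1 the inward step changes the arm index, since [(i, 0)] is not a vertex. *)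
exists (size l, 0); rewrite mem_head /spider_dist /= (negbTE i_l).
rewrite [j == i]eq_sym (negbTE nij).
case: eqP rl => [-> | jl] rl; rewrite ?ltnn in rl; split; lia.
Qed.

Section Distance.
Variables (G : sgraph) (l : seq nat) (f : G -> nat * nat).
Hypothesis coordf : coordinates l f.

Lemma coordinates_inj : injective f.
Proof.
apply/injectiveP; have := uniq_spider l.
by rewrite -(perm_uniq coordf.1).
Qed.

Lemma coordinates_mem x : f x \in spider l.
Proof. by case: coordf => pf _; rewrite -(perm_mem pf) codom_f. Qed.

Lemma coordinates_geodesic x y :
  exists p, [/\ simple_path x p, last x p = y &
                size p = spider_dist (f x) (f y)].
Proof.
have [ef pf] := (coordf.2, coordf.1).
(* The induction also carries that all later vertices are strictly closer to [y] than [x] is; this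
   keeps the path simple when a vertex is prepended. *)
suff [p [ep lp sp _]]: exists p, [/\ simple_path x p, last x p = y,
    size p = spider_dist (f x) (f y) &
    all (fun z => spider_dist (f y) (f z) < spider_dist (f y) (f x)) p].
  by exists p.
have [n] := ubnP (spider_dist (f y) (f x)); elim: n x => // n IHn x ltn.
have [->|nxy] := eqVneq x y.
  by exists [::]; rewrite /spider_dist eqxx subnn.
have [|q [ql d1 ds]] :=
  spider_dist_step (coordinates_mem x) (coordinates_mem y).
  by rewrite (inj_eq coordinates_inj).
have /codomP[z Ez] : q \in codom f by rewrite (perm_mem pf).
rewrite {q}Ez in ql d1 ds; rewrite ds ltnS in ltn.
have [p [/andP[ep up] lp sp ap]] := IHn z ltn.
exists (z :: p); split => //=.
- rewrite /= in up.
  rewrite /simple_path /= ef d1 eqxx ep up inE negb_or !andbT /=.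
  apply/andP; split.
    by apply/eqP=> E; move: ds; rewrite E => /n_Sn.
  by apply/negP=> xp; have := allP ap _ xp; lia.
- by rewrite sp spider_distC [RHS]spider_distC.
- rewrite ds ltnSn; apply: sub_all ap => w; exact: ltnW.
Qed.

Hypothesis acG : acyclic G.

Lemma coordinates_size x p :
  simple_path x p -> size p = spider_dist (f x) (f (last x p)).
Proof.
move=> sp; have [q [sq lq <-]] := coordinates_geodesic x (last x p).
by rewrite (acyclic_simple_path_inj acG sp sq).
Qed.

Lemma coordinates_nth x p i j :
  simple_path x p -> i <= j <= size p ->
  spider_dist (f (nth x (x :: p) i)) (f (nth x (x :: p) j)) <= j - i.
Proof.
case/andP=> /(pathP x) ep _ /andP[]; elim: j => [|j IHj].
  by rewrite leqn0 => /eqP-> _; rewrite /spider_dist eqxx subnn.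
rewrite leq_eqVlt => /predU1P[-> _|ij jp].
  by rewrite /spider_dist eqxx !subnn.
apply: leq_trans (spider_dist_triangle _ (f (nth x (x :: p) j)) _) _.
by have := ep j jp; rewrite coordf.2 => /eqP->; have := IHj ij (ltnW jp); lia.
Qed.

(** Distance is at most the difference of positions along the path, so distance [size p] forces the
    positions 0 and [size p]. *)
Lemma coordinates_endpoints x p u w :
  simple_path x p -> u \in x :: p -> w \in x :: p ->
  spider_dist (f u) (f w) = size p -> 0 < size p ->
  u = x /\ w = last x p \/ u = last x p /\ w = x.
Proof.
move=> sp /(nthP x)[i ip <-] /(nthP x)[j jp <-]; rewrite /= !ltnS in ip jp.
have -> : last x p = nth x (x :: p) (size p) by rewrite (last_nth x).
move=> D p0.
have aux a b : a <= b <= size p -> spider_dist (f (nth x (x :: p) a))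
  (f (nth x (x :: p) b)) = size p -> a = 0 /\ b = size p.
  by move=> ab Dab; have := coordinates_nth sp ab; lia.
case/orP: (leq_total i j) => le.
  by have [|-> ->] := aux i j _ D; [rewrite le | left].
rewrite spider_distC in D.
by have [|-> ->] := aux j i _ D; [rewrite le | right].
Qed.

(* The endpoints are recovered from the vertex set as its only two vertices at
   maximal distance. *)
Lemma coordinates_same_vertices (x y : G) p q :
  simple_path x p -> simple_path y q -> size p = size q -> 0 < size p ->
  x :: p =i y :: q -> y :: q = x :: p \/ y :: q = rev (x :: p).
Proof.
move=> sp sq Epq p0 Exy.
have yx : y \in x :: p by rewrite Exy mem_head.
have lx : last y q \in x :: p by rewrite Exy mem_last.
have := coordinates_size sq; rewrite -Epq => /esym D.
have [[Ey Eq]|[Ey Eq]] := coordinates_endpoints sp yx lx D p0; subst y.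
  by left; rewrite (acyclic_simple_path_inj acG sp sq).
right; rewrite [x :: p]lastI rev_rcons; congr (_ :: _).
apply: (acyclic_simple_path_inj acG sq (simple_path_rev sp)).
by rewrite Eq; case: (p) => //= a r; rewrite rev_cons last_rcons.
Qed.

End Distance.

(** * Paths counted by ordered pairs of ends *)

Lemma zip_swap (T : Type) (s t : seq T) :
  zip t s = [seq (u.2, u.1) | u <- zip s t].
Proof. by elim: s t => [|a s IHs] [|b t] //=; rewrite IHs. Qed.

Lemma trace_rev (G : sgraph) (s : seq G) : trace (rev s) = trace s.
Proof.
rewrite /trace; congr (_, _).
  by apply/setP=> z; rewrite !inE mem_rev.
case: s => [|x p] //.
have -> : zip (x :: p) (behead (x :: p)) = zip (belast x p) p.
  rewrite [behead _]/= {1}lastI -cats1 -[X in zip _ X = _]cats0.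
  by rewrite zip_cat ?size_belast // cats0.
rewrite {2}lastI rev_rcons rev_cons [behead (last _ _ :: _)]/=.
rewrite -cats1 -[X in zip _ X]cats0 zip_cat ?size_rev ?size_belast // cats0.
rewrite -rev_zip ?size_belast // zip_swap; apply/setP=> e.
apply/imsetP/imsetP=> -[[a b]].
  rewrite mem_rev => /mapP[[a' b'] ab [-> ->]] ->; exists (a', b') => //.
  by rewrite setUC.
move=> ab ->; exists (b, a); last by rewrite setUC.
by rewrite mem_rev; apply/mapP; exists (a, b).
Qed.

(** Both sides count the set [A] of vertex sequences of paths: each trace comes from exactly two
    sequences, and a sequence is determined by its ends, which may be any ordered pair at distance
    [h]. *)
Lemma num_paths_coordinates (G : sgraph) l (f : G -> nat * nat) h :
  acyclic G -> coordinates l f -> 0 < h ->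
  (num_paths G h).*2 =
  \sum_(p <- spider l) \sum_(q <- spider l) (spider_dist p q == h).
Proof.
move=> acG cf h0.
pose A := [set t : h.+1.-tuple G | uniq t && sorted (@edge G) t].
have consA x (p : h.-tuple G) : ([tuple of x :: p] \in A) = simple_path x p.
  by rewrite inE andbC.
pose ends (t : h.+1.-tuple G) := (thead t, last (thead t) t).
have ends_cons x (p : h.-tuple G) : ends [tuple of x :: p] = (x, last x p).
  by rewrite /ends theadE.
transitivity #|A|.
  have -> : #|A| = \sum_(t in A) 1 by rewrite sum1_card.
  rewrite (partition_big_imset (fun t : h.+1.-tuple G => trace t)) /=.
  rewrite -muln2 -sum_nat_const; apply: eq_bigr => _ /imsetP[t tA ->].
  rewrite -/A in tA; rewrite -big_set sum1_card; symmetry.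
  have revA s : s \in A -> [tuple of rev s] \in A.
    rewrite !inE rev_uniq rev_sorted => /andP[-> es] /=.
    by rewrite (eq_sorted (e' := @edge G)) // => u v; exact: edge_sym.
  have -> : [set s | (s \in A) && (trace s == trace t)] =
      [set t; [tuple of rev t]].
    apply/setP=> s; rewrite in_set in_set2.
    apply/idP/orP; last first.
      by case=> /eqP->; rewrite ?tA ?revA ?trace_rev ?eqxx.
    case/andP=> sA /eqP[/setP Est _].
    case/tupleP: t => x p in tA Est *; case/tupleP: s => y q in sA Est *.
    rewrite !consA in tA sA.
    have Est' : x :: p =i y :: q by move=> z; have := Est z; rewrite !inE.
    have := coordinates_same_vertices cf acG tA sA.
    rewrite !size_tuple => /(_ erefl h0 Est')[] E; [left | right];
      by apply/eqP/val_inj.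
  (* A sequence equal to its reversal would have equal ends, hence length 0, against [0 < h]. *)
  rewrite cards2 (_ : t != _) //; apply/eqP=> /(congr1 val) /=.
  case/tupleP: t => x p in tA *; rewrite consA in tA.
  rewrite /= {2}lastI rev_rcons => -[/esym/(simple_path_loop tA) p_nil _].
  by have := size_tuple p; rewrite p_nil => h_0; rewrite -h_0 in h0.
have -> : #|A| = #|ends @: A|.
  rewrite card_in_imset // => s t.
  case/tupleP: s => x p; case/tupleP: t => y q; rewrite !consA !ends_cons.
  move=> sp sq [Exy Epq]; subst y; apply: val_inj.
  by rewrite /= (acyclic_simple_path_inj acG sp sq).
have -> : ends @: A = [set u | spider_dist (f u.1) (f u.2) == h].
  apply/setP=> -[x y]; rewrite inE /=; apply/imsetP/idP.
    case=> t; case/tupleP: t => z p; rewrite consA ends_cons => sp [-> ->].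
    by rewrite -(coordinates_size cf acG sp) size_tuple.
  have [p [sp lp <-]] := coordinates_geodesic cf x y => /eqP sz.
  have szp : size p == h by apply/eqP.
  exists [tuple of x :: Tuple szp]; first by rewrite consA.
  by rewrite ends_cons /= lp.
rewrite -(perm_big _ cf.1) big_map big_enum.
under [RHS]eq_bigr do rewrite -(perm_big _ cf.1) big_map big_enum.
rewrite pair_bigA /= -sum1_card big_mkcond.
by apply: eq_bigr => u _; rewrite inE; case: eqP.
Qed.

(** * Pairs at a given distance in terms of arm lengths *)

Lemma sum_iota_eq (n t : nat) : \sum_(m <- iota 1 n) (m == t) = (0 < t <= n).
Proof.
elim: n => [|n IHn]; first by rewrite big_nil; lia.
rewrite -[n.+1]addn1 iotaD big_cat big_seq1 /= IHn; lia.
Qed.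

Lemma sum_iota_leC (a b : nat) (F : nat -> nat) :
  \sum_(m <- iota 1 a) (m <= b) * F m = \sum_(m <- iota 1 b) (m <= a) * F m.
Proof.
have aux n k : \sum_(m <- iota 1 n) (m <= k) * F m =
    \sum_(m <- [seq m <- iota 1 n | m <= k]) F m.
  rewrite big_filter [RHS]big_mkcond; apply: eq_bigr => m _.
  by case: leqP; rewrite ?mul1n ?mul0n.
rewrite !aux; apply: perm_big.
apply: uniq_perm; rewrite ?filter_uniq ?iota_uniq //.
by move=> m; rewrite !mem_filter !mem_iota; lia.
Qed.

Lemma sum_iota_add (a b h : nat) :
  \sum_(m <- iota 1 a) \sum_(n <- iota 1 b) (m + n == h.+1) =
  \sum_(m <- iota 1 h) (m <= a) * (h.+1 - m <= b).
Proof.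
rewrite -sum_iota_leC; apply: eq_big_seq => m; rewrite mem_iota => ma.
rewrite (eq_big_seq (fun n => ((n == h.+1 - m) : nat))); last first.
  by move=> n; rewrite mem_iota; lia.
rewrite sum_iota_eq; lia.
Qed.

(** On a path with vertices 0, ..., [n], the first two terms count the ordered pairs at distance
    [h + 1], with and without the end 0. They total [2 max(n - h, 0)], and the last sum is
    [min(h, n)]. *)
Lemma sum_iota_dist (n h : nat) :
  (h < n).*2 +
  \sum_(i <- iota 1 n) \sum_(j <- iota 1 n) (i - j + (j - i) == h.+1) +
  (\sum_(i <- iota 1 h) (i <= n)).*2 = n.*2.
Proof.
elim: n => [|n IHn].
  rewrite big_nil big1_seq //= => i; rewrite mem_iota; lia.
have last_row : \sum_(i <- iota 1 n) (n.+1 - i + (i - n.+1) == h.+1) = (h < n).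
  rewrite (eq_big_seq (fun i => (i == n - h) : nat)).
    by rewrite sum_iota_eq; lia.
  by move=> i; rewrite mem_iota; lia.
have -> : \sum_(i <- iota 1 h) (i <= n.+1) =
    \sum_(i <- iota 1 h) (i <= n) + (n < h).
  rewrite (eq_bigr (fun i => (i <= n) + (i == n.+1))).
    by rewrite big_split /= sum_iota_eq.
  by move=> i _; lia.
rewrite -[n.+1]addn1 iotaD big_cat /= big_seq1 add1n.
rewrite (eq_bigr (fun i => \sum_(j <- iota 1 n) (i - j + (j - i) == h.+1) +
  (n.+1 - i + (i - n.+1) == h.+1))); last first.
  by move=> i _; rewrite big_cat big_seq1 addnC.
rewrite big_split /= last_row big_cat big_seq1 /=.
rewrite last_row; lia.
Qed.

(** The number [a_m] of the overview; for [m > 0] these form the conjugate partition of the arm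
    lengths. *)
Definition count_ge (l : seq nat) (m : nat) : nat := count (leq m) l.

Lemma count_geE l m :
  count_ge l m = \sum_(i <- iota 0 (size l)) (m <= nth 0 l i).
Proof.
rewrite /count_ge -sum1_count big_mkcond (big_nth 0) /index_iota subn0.
by apply: eq_bigr => i _; case: leq.
Qed.

(* T i j counts the pairs at distance h + 1 on arms i and j as if i and j were
   different; U i is the actual count for i = j. *)
Lemma spider_dist_count (l : seq nat) (h : nat) :
  \sum_(p <- spider l) \sum_(q <- spider l) (spider_dist p q == h.+1) +
  \sum_(m <- iota 1 h) count_ge l (maxn m (h.+1 - m)) +
  (\sum_(m <- iota 1 h) count_ge l m).*2 =
  (sumn l).*2 + \sum_(m <- iota 1 h) count_ge l m * count_ge l (h.+1 - m).
Proof.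
set K := iota 0 (size l); pose L i := nth 0 l i.
have mem_K i : i \in K -> i < size l by rewrite mem_iota => /andP[].
pose T i j := \sum_(m <- iota 1 (L i)) \sum_(n <- iota 1 (L j)) (m + n == h.+1).
pose U i := \sum_(m <- iota 1 (L i)) \sum_(n <- iota 1 (L i))
  (m - n + (n - m) == h.+1).
have center i m : i \in K -> spider_dist (size l, 0) (i, m) = m.
  by move=> /mem_K il; rewrite /spider_dist /= gtn_eqF.
have sum_leg i : \sum_(m <- iota 1 (L i)) (m == h.+1) = (h < L i).
  by rewrite sum_iota_eq.
have sum_legs : \sum_(i <- K) \sum_(m <- iota 1 (L i)) (m == h.+1) =
    count_ge l h.+1.
  by rewrite count_geE; apply: eq_bigr => i _; rewrite sum_leg.
have sum_center : \sum_(q <- spider l) (spider_dist (size l, 0) q == h.+1) =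
    count_ge l h.+1.
  rewrite big_cons big_allpairs_dep -sum_legs.
  by rewrite {1}/spider_dist /= eqxx; apply: eq_big_seq => i iK;
     apply: eq_bigr => m _; rewrite center.
(* The rows of [T] are uniform in [j]; only the diagonal entry must be exchanged for [U i]. *)
have sum_pair i : i \in K ->
    \sum_(j <- K) \sum_(m <- iota 1 (L i)) \sum_(n <- iota 1 (L j))
      (spider_dist (i, m) (j, n) == h.+1) + T i i = \sum_(j <- K) T i j + U i.
  move=> iK; rewrite (bigD1_seq i) ?iota_uniq //=.
  rewrite [in RHS](bigD1_seq i) ?iota_uniq //=.
  rewrite [X in X + _ + _](_ : _ = U i); last first.
    apply: eq_bigr => m _; apply: eq_bigr => n _.
    by rewrite /spider_dist /= eqxx.
  rewrite [X in _ + X + _](_ : _ = \sum_(j <- K | j != i) T i j); first by lia.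
  apply: eq_bigr => j ji; apply: eq_bigr => m _; apply: eq_bigr => n _.
  by rewrite /spider_dist /= [i == j]eq_sym (negbTE ji).
have sum_row i m : i \in K ->
    \sum_(q <- spider l) (spider_dist (i, m) q == h.+1) = (m == h.+1) +
    \sum_(j <- K) \sum_(n <- iota 1 (L j)) (spider_dist (i, m) (j, n) == h.+1).
  move=> iK; rewrite big_cons big_allpairs_dep.
  by rewrite spider_distC center.
rewrite {1}/spider big_cons sum_center big_allpairs_dep.
rewrite (eq_big_seq (fun i => (h < L i) + \sum_(j <- K)
  \sum_(m <- iota 1 (L i)) \sum_(n <- iota 1 (L j))
      (spider_dist (i, m) (j, n) == h.+1))); last first.
  move=> i iK; rewrite (eq_bigr _ (fun m _ => sum_row i m iK)) big_split /=.
  by rewrite sum_leg exchange_big.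
rewrite big_split /=.
have -> : \sum_(i <- K) (h < L i) = count_ge l h.+1 by rewrite count_geE.
(* For fixed [m], arms [i] and [j] contribute when they reach [m] and [h + 1 - m]; these choices are
   independent, whence the product. *)
have sum_T : \sum_(i <- K) \sum_(j <- K) T i j =
    \sum_(m <- iota 1 h) count_ge l m * count_ge l (h.+1 - m).
  under eq_bigr => i _.
    rewrite (eq_bigr _ (fun j _ => sum_iota_add _ _ _)) exchange_big.
    over.
  rewrite exchange_big /=; apply: eq_bigr => m _.
  by rewrite !count_geE big_distrlr.
have sum_Tii : \sum_(i <- K) T i i =
    \sum_(m <- iota 1 h) count_ge l (maxn m (h.+1 - m)).
  rewrite (eq_bigr _ (fun i _ => sum_iota_add _ _ _)) exchange_big /=.
  apply: eq_bigr => m _; rewrite count_geE; apply: eq_bigr => i _.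
  by rewrite geq_max mulnb.
have sum_U : \sum_(i <- K) U i + (count_ge l h.+1).*2 +
    (\sum_(m <- iota 1 h) count_ge l m).*2 = (sumn l).*2.
  have -> : sumn l = \sum_(i <- K) L i.
    by rewrite sumnE (big_nth 0) /index_iota subn0.
  rewrite count_geE (eq_bigr _ (fun m _ => count_geE l m)) exchange_big /=.
  rewrite -!muln2 !big_distrl -!big_split /=; apply: eq_bigr => i _.
  have := sum_iota_dist (L i) h; rewrite -!muln2 => <-.
  by rewrite addnAC addnC addnA.
have := @eq_big_seq _ 0 addn _ K _ _ sum_pair.
rewrite !big_split /= sum_T sum_Tii => E.
rewrite -sum_U -/K; lia.
Qed.

(** * Arm lengths recovered from the counts *)

Lemma count_geS l m : count_ge l m = count_mem m l + count_ge l m.+1.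
Proof. by rewrite /count_ge; elim: l => //= k l ->; lia. Qed.

(** The multiplicity of [m] is [a_m - a_(m+1)]. As no length is 0, [a_0 = a_1]. *)
Lemma count_ge_perm l l' : all (leq 1) l -> all (leq 1) l' ->
  (forall m, 0 < m -> count_ge l m = count_ge l' m) -> perm_eq l l'.
Proof.
move=> pl pl' H.
have no0 k : all (leq 1) k -> count_mem 0 k = 0.
  by move=> pk; apply/count_memPn/negP=> /(allP pk).
have H0 m : count_ge l m = count_ge l' m.
  case: m => [|m]; last exact: H.
  by rewrite !(count_geS _ 0) H // !no0.
apply/allP=> m _ /=; rewrite -(eqn_add2r (count_ge l m.+1)) -count_geS.
by rewrite !H0 -count_geS.
Qed.

Lemma spider_dist_count_inj l l' :
  2 < count_ge l 1 -> 2 < count_ge l' 1 ->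
  (forall h, 0 < h ->
    \sum_(p <- spider l) \sum_(q <- spider l) (spider_dist p q == h) =
    \sum_(p <- spider l') \sum_(q <- spider l') (spider_dist p q == h)) ->
  forall m, 0 < m -> count_ge l m = count_ge l' m.
Proof.
move=> l3 l3' H.
have E h := spider_dist_count l h; have E' h := spider_dist_count l' h.
(* At distance 1 all correction sums are empty, leaving twice the number of edges. *)
have En : (sumn l).*2 = (sumn l').*2.
  by move: (E 0) (E' 0); rewrite (H 1) // !big_nil; lia.
elim/ltn_ind=> -[//|[|g]] IHm _.
  move: (E 1) (E' 1); rewrite (H 2) // !big_seq1 En /=.
  rewrite subn1 /= maxnn; move: (\sum_(p <- _) _) (sumn l') => Q n.
  move: (count_ge l 1) (count_ge l' 1) l3 l3' => a b a3 b3 Ea Eb.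
  (* Distance 2 gives [Q + 3a = 2n + a^2], and [(a - 3) a] is strictly increasing for [a >= 3]. *)
  have /eqP: (a - 3) * a = (b - 3) * b by nia.
  by case: (ltngtP a b) => // ab; nia.
move: (E g.+2) (E' g.+2); rewrite (H g.+3) // En.
move: (\sum_(p <- _) _) => Q.
(* At distance [g + 3] the unknown [a_(g+2)] occurs only in the first and last terms of the sums;
   the middle terms agree by induction. *)
have iotaE : iota 1 g.+2 = 1 :: rcons (iota 2 g) g.+2.
  by rewrite -[in LHS](addn1 g.+1) iotaD cats1.
rewrite iotaE !big_cons !big_rcons /=.
have IH1 : count_ge l 1 = count_ge l' 1 by apply: IHm.
have mid (F : (nat -> nat) -> nat -> nat) :
  (forall a a' m, 1 < m < g.+2 -> (forall k, 0 < k < g.+2 -> a k = a' k) ->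
    F a m = F a' m) ->
  \sum_(m <- iota 2 g) F (count_ge l) m =
  \sum_(m <- iota 2 g) F (count_ge l') m.
  move=> HF; apply: eq_big_seq => m; rewrite mem_iota => mg.
  apply: HF; first by lia.
  by move=> k /andP[k0 kg]; apply: IHm.
rewrite (mid (fun a m => a (maxn m (g.+3 - m)))); last first.
  by move=> a a' m mg; apply; lia.
rewrite (mid (fun a m => a m)); last by move=> a a' m mg; apply; lia.
rewrite (mid (fun a m => a m * a (g.+3 - m))); last first.
  by move=> a a' m mg Ha; rewrite !Ha //; lia.
rewrite IH1 !subn1 /= subSS subSn // subnn.
rewrite (maxn_idPr _) // (maxn_idPl _) //.
(* What remains is linear in [a_(g+2)], with coefficient [2 (a_1 - 2) > 0]. *)
nia.
Qed.

(** * Isomorphisms and path sequences *)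

Lemma coordinates_isomorphic (G H : sgraph) l f g :
  @coordinates G l f -> @coordinates H l g -> isomorphic G H.
Proof.
move=> cf cg.
have fg x : exists y, g y == f x.
  have: f x \in codom g by rewrite (perm_mem cg.1) (coordinates_mem cf).
  by case/codomP=> y ->; exists y.
have gf y : exists x, f x == g y.
  have: g y \in codom f by rewrite (perm_mem cf.1) (coordinates_mem cg).
  by case/codomP=> x ->; exists x.
exists (fun x => xchoose (fg x)); last first.
  by move=> x y; rewrite cf.2 cg.2 !(eqP (xchooseP (fg _))).
exists (fun y => xchoose (gf y)) => [x|y].
  apply: (coordinates_inj cf).
  by rewrite (eqP (xchooseP (gf _))) (eqP (xchooseP (fg _))).
apply: (coordinates_inj cg).
by rewrite (eqP (xchooseP (fg _))) (eqP (xchooseP (gf _))).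
Qed.

Lemma isomorphic_coordinates (G H : sgraph) l f :
  isomorphic G H -> @coordinates G l f -> exists g, @coordinates H l g.
Proof.
case=> phi [psi phiK psiK] phiE [pf ef]; exists (f \o psi); split.
  apply: perm_trans pf; rewrite /codom /image_mem (map_comp f psi) perm_map //.
  apply: uniq_perm; rewrite ?(map_inj_uniq (can_inj psiK)) ?enum_uniq // => x.
  by rewrite mem_enum -[x]phiK map_f ?mem_enum.
by move=> x y; rewrite -{1}(psiK x) -{1}(psiK y) phiE ef.
Qed.

Lemma num_paths0 (G : sgraph) : num_paths G 0 = #|G|.
Proof.
rewrite /num_paths /paths.
have -> : [set t : 1.-tuple G | uniq t && sorted (@edge G) t] =
    [set: 1.-tuple G].
  by apply/setP=> t; rewrite !inE; case/tupleP: t => x t; rewrite tuple0.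
rewrite card_imset ?cardsT ?card_tuple ?expn1 // => s t.
case/tupleP: s => x s; case/tupleP: t => y t.
rewrite (tuple0 s) (tuple0 t) => -[/setP/(_ x)].
by rewrite !inE eqxx => /esym/eqP->.
Qed.

Lemma num_paths_eq0 (G : sgraph) h : longest_path G < h -> num_paths G h = 0.
Proof.
move=> lh; have [hG|hG] := ltnP h #|G|.
  apply/eqP; rewrite -leqn0 leqNgt; apply: contraL lh => P0.
  by rewrite -leqNgt (leq_bigmax_cond (Ordinal hG)).
apply/eqP; rewrite cards_eq0 -subset0; apply/subsetP=> z /imsetP[t + _].
rewrite inE => /andP[/card_uniqP ct _]; have := max_card [in t].
by rewrite ct size_tuple ltnNge hG.
Qed.

(** The size of the sequence gives the longest length, beyond which all counts vanish. Conversely,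
    [P_0] gives the number of vertices, which bounds the range of the maximum. *)
Lemma path_sequence_eqP (G H : sgraph) :
  path_sequence G = path_sequence H <-> num_paths G =1 num_paths H.
Proof.
split=> [E h|E].
  have El : longest_path G = longest_path H.
    by have := congr1 size E; rewrite !size_mkseq => -[].
  have [hG|hG] := leqP h (longest_path G); last first.
    by rewrite !num_paths_eq0 -?El.
  by have := congr1 (nth 0 ^~ h) E; rewrite !nth_mkseq // -?El.
have EG : #|G| = #|H| by rewrite -!num_paths0.
have El : longest_path G = longest_path H.
  by rewrite /longest_path EG; apply: eq_bigl => h; rewrite E.
by rewrite /path_sequence El; apply: eq_mkseq.
Qed.

Theorem theorem7 (n n' : nat) (S S' : sgraph)
    (hn : #|S| = n) (hn' : #|S'| = n')
    (hS : starlike S) (hS' : starlike S') :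
  isomorphic S S' <-> path_sequence S = path_sequence S'.
Proof.
have [l [f [sl l3 pl cf]]] := starlike_coordinates hS.
have [l' [f' [sl' l3' pl' cf']]] := starlike_coordinates hS'.
have [[_ acS] [_ acS']] := (hS.1, hS'.1).
split=> [iso|/path_sequence_eqP E].
  apply/path_sequence_eqP=> -[|h].
    rewrite !num_paths0; case: iso => phi bphi _; exact: bij_eq_card bphi.
  (* With coordinates over the same [l], both graphs have their paths counted by the same sum. *)
  have [g cg] := isomorphic_coordinates iso cf.
  by apply: double_inj; rewrite (num_paths_coordinates acS cf) //
    (num_paths_coordinates acS' cg).
suff Ell : l = l' by rewrite -Ell in cf'; exact: coordinates_isomorphic cf cf'.
(* Both lists are sorted, so equality as multisets suffices. *)
apply: (sorted_eq _ _ sl sl').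
- by move=> a b c ba ac; exact: leq_trans ac ba.
- by move=> a b ab; apply/anti_leq; rewrite andbC.
have ge1 k : all (leq 1) k -> 2 < size k -> 2 < count_ge k 1.
  by rewrite all_count => /eqP; rewrite /count_ge => ->.
apply: (count_ge_perm pl pl').
apply: spider_dist_count_inj (ge1 _ pl l3) (ge1 _ pl' l3') _.
move=> h h0; rewrite -(num_paths_coordinates acS cf h0).
by rewrite -(num_paths_coordinates acS' cf' h0) E.
Qed.
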